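(* Let $\mathcal B$ and $\mathcal B^*$ be flat objects with $n$ vertices $\vec r_i$ and $\vec r_i^*$ respectively, mass density distributions $\delta$ and $\delta^*$, and the same coefficient of restitution. Suppose that $\mathcal B^*$ is an affine image of $\mathcal B$ in the sense that, for an invertible matrix $$\vec S=\begin{bmatrix}a&b&0\\c&d&0\\0&0&1\end{bmatrix},\quad a,b,c,d\in\mathbb R,$$ one has $\vec r_i^*=\vec S\vec r_i$ for all $i$, and $\delta^*(\vec S\vec r)=\chi\,\delta(\vec r)$ for some $\chi\in\mathbb R$. Suppose furthermore that the initial generalized coordinates and velocities $\vec q,\vec p$ of $\mathcal B$ and $\vec q^*,\vec p^*$ of $\mathcal B^*$ are related by $$\vec q^*=\vec S_p^{-T}\vec q,\qquad \vec p^*=\vec S_p^{-T}\vec p,\qquad \vec S_p:=\vec P_{-\pi/2}\vec S\vec P_{\pi/2}.$$ Then these two relations are preserved during the entire motion, and thus $\mathcal B^*$ undergoes complete chatter (CC) if and only if $\mathcal B$ does so.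
   Context: Model (linearized kinematics, no friction, no gravity or other external forces). A flat rigid body has its mass and its $n$ potential contact points (vertices) in the plane $z=0$ of a local frame centred at its centre of mass (the thickness is neglected); vertex $i$ is $\vec r_i=(x_i,y_i,0)^T$. The body moves above a fixed plane $\mathcal P$. Generalized coordinates are $\vec q=(\phi_x,\phi_y,h)^T\in\mathbb R^3$ (small rotations and normal displacement of the centre of mass), generalized velocities are $\vec p=\dot{\vec q}\in\mathbb R^3$. Let $\vec u_3=(0,0,1)^T$ and $\vec P_\alpha=\begin{bmatrix}\cos\alpha&-\sin\alpha&0\\\sin\alpha&\cos\alpha&0\\0&0&1\end{bmatrix}$. With $\vec f_i=(y_i,-x_i,1)^T=\vec P_{-\pi/2}(\vec r_i+\vec u_3)$, the distance of vertex $i$ from $\mathcal P$ is $h_i=\vec f_i^T\vec q$ and its normal velocity is $v_i=\vec f_i^T\vec p$; admissible configurations have all $h_i\ge0$. Between impacts $\vec p$ is constant. An impact occurs at vertex $i$ when $h_i=0$ and $v_i<0$; then $\vec q$ is unchanged and $\vec p$ is replaced by $\vec U_i\vec p$, where $$\vec U_i=\vec I-\frac{1+\gamma}{\vec f_i^T\vec\Theta^{-1}\vec f_i}\vec\Theta^{-1}\vec f_i\vec f_i^T,$$ $\gamma\in(0,1)$ is the coefficient of restitution, and $\vec\Theta$ is the generalized mass matrix $$\vec\Theta=\int\delta(\vec r)\,\vec P_{-\pi/2}(\vec r+\vec u_3)(\vec r+\vec u_3)^T\vec P_{\pi/2}\,dV,$$ the integral being over the body, with $\delta$ its mass density. All of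 this applies to $\mathcal B^*$ with its own data (marked by an asterisk). Impacts occur at single vertices (simultaneous impacts are not modelled). $\vec S_p^{-T}$ denotes the inverse of the transpose of $\vec S_p$. Complete chatter (CC): the object undergoes an infinite sequence of collisions in finite time, after which its velocity relative to the surface becomes zero. *)

(* Defs.v *)
From mathcomp Require Import all_boot all_order all_algebra.
From mathcomp Require Import all_classical all_reals all_analysis.
Import Order.TTheory GRing.Theory Num.Theory.
Import numFieldNormedType.Exports.

Set Implicit Arguments.
Unset Strict Implicit.
Unset Printing Implicit Defensive.

Local Open Scope classical_set_scope.
Local Open Scope ring_scope.

Definition mx3 (R : realType) (rows : seq (seq R)) : 'M[R]_3 :=
  \matrix_(i < 3, j < 3) (nth [::] rows i)`_j.

Definition u3 (R : realType) : 'cV[R]_3 := \col_(i < 3) [:: 0; 0; 1]`_i.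

Definition P (R : realType) (alpha : R) : 'M[R]_3 :=
  mx3 [:: [:: cos alpha; - sin alpha; 0];
          [:: sin alpha; cos alpha; 0];
          [:: 0; 0; 1]].

(* The point (x, y, 0) of the plane of the body, for xy = (x, y). *)
Definition plane_pt (R : realType) (xy : R * R) : 'cV[R]_3 :=
  \col_(i < 3) [:: xy.1; xy.2; 0]`_i.

Definition area (R : realType) :
    {measure set (measurableTypeR R * measurableTypeR R)%type -> \bar R} :=
  (@lebesgue_measure R \x @lebesgue_measure R)%E.

(* The thickness being neglected, [density] is a mass per unit area of the
   plane z = 0 and the volume element of the model is the area element.  It
   vanishes off the body, so integrals over the body are taken over the plane;
   its values at points with z <> 0 are never used. *)
Record flat_body (R : realType) (n : nat) := FlatBody {
  vertex : 'I_n -> 'cV[R]_3;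
  vertex_flat : forall i, vertex i ord_max 0 = 0;
  density : 'cV[R]_3 -> R;
  density_ge0 : forall xy, 0 <= density (plane_pt xy);
  density_integrable :
    (area R).-integrable setT (fun xy => (density (plane_pt xy))%:E);
  moment2_integrable :
    (area R).-integrable setT
      (fun xy => (density (plane_pt xy) * (xy.1 ^+ 2 + xy.2 ^+ 2))%:E);
  mass_gt0 : 0 < \int[area R]_(xy in setT) density (plane_pt xy);
  centre_of_mass : forall k,
    \int[area R]_(xy in setT) (density (plane_pt xy) * plane_pt xy k 0) = 0;
  restitution : R;
  restitution_itv : 0 < restitution < 1 }.

Section Model.
Context (R : realType) (n : nat) (B : flat_body R n).
Implicit Types (i j : 'I_n) (q p : 'cV[R]_3) (t : R).

Definition contact_dir i : 'cV[R]_3 := P (- (pi / 2)) *m (vertex B i + u3 R).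

Lemma contact_dirE i :
  contact_dir i = \col_(k < 3) [:: vertex B i 1 0; - vertex B i 0 0; 1]`_k.
Proof.
apply/matrixP => k l; rewrite (ord1 l) !mxE !big_ord_recl big_ord0 !mxE /=.
rewrite cosN sinN cos_pihalf sin_pihalf opprK.
have e1 : lift ord0 ord0 = 1 :> 'I_3 by apply/val_inj.
have e2 : lift ord0 (lift ord0 ord0) = ord_max :> 'I_3 by apply/val_inj.
rewrite ?e1 ?e2 vertex_flat; case: k => -[|[|[|]]] //= _.
all: by rewrite ?(mul0r, mul1r, mulN1r, addr0, add0r).
Qed.

Definition gap i q : R := ((contact_dir i)^T *m q) 0 0.

Definition normal_velocity i p : R := ((contact_dir i)^T *m p) 0 0.

Definition admissible q : Prop := forall i, 0 <= gap i q.

Definition mass_matrix : 'M[R]_3 :=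
  \matrix_(k < 3, l < 3)
    \int[area R]_(xy in setT)
      (density B (plane_pt xy) *
       (P (- (pi / 2)) *m (plane_pt xy + u3 R) *m (plane_pt xy + u3 R)^T
          *m P (pi / 2)) k l).

Definition impact_mx i : 'M[R]_3 :=
  let f := contact_dir i in
  1%:M - ((1 + restitution B) / (f^T *m invmx mass_matrix *m f) 0 0)
           *: (invmx mass_matrix *m f *m f^T).

Definition impacting i q p : Prop := gap i q = 0 /\ normal_velocity i p < 0.

(* [reach q0 p0 k t q p]: (q, p) is the state at time t after k impacts of the
   body released from (q0, p0) at time 0.  The index k separates the states
   before and after an impact, which occur at the same time.  Admissibility
   along a flight prevents it from continuing past an impact.  There is no
   [reach_impact] step from a state in which several vertices are impacting:
   the model does not define the motion beyond a simultaneous impact. *)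
Inductive reach q0 p0 : nat -> R -> 'cV[R]_3 -> 'cV[R]_3 -> Prop :=
| reach_start : admissible q0 -> reach q0 p0 0 0 q0 p0
| reach_flight k t q p dt :
    reach q0 p0 k t q p -> 0 <= dt ->
    (forall s, 0 <= s <= dt -> admissible (q + s *: p)) ->
    reach q0 p0 k (t + dt) (q + dt *: p) p
| reach_impact k t q p i :
    reach q0 p0 k t q p -> impacting i q p ->
    (forall j, impacting j q p -> j = i) ->
    reach q0 p0 k.+1 t q (impact_mx i *m p).

(* Infinitely many impacts accumulate at time T, where the velocity vanishes
   and the configuration is qT.  The convergence of q_ follows from that of t_
   and p_; it only serves to name the final configuration. *)
Definition chatters_to_rest q0 p0 (T : R) (qT : 'cV[R]_3) : Prop :=
  exists (t_ : nat -> R) (q_ p_ : nat -> 'cV[R]_3),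
    [/\ forall k, reach q0 p0 k (t_ k) (q_ k) (p_ k),
        t_ @ \oo --> T,
        q_ @ \oo --> qT &
        p_ @ \oo --> (0 : 'cV[R]_3)].

Definition complete_chatter q0 p0 : Prop :=
  exists T qT, chatters_to_rest q0 p0 T qT.

(* The whole motion: phase [Some k] consists of the states following exactly k
   impacts, phase [None] of the rest following a complete chatter. *)
Definition motion q0 p0 (phase : option nat) t q p : Prop :=
  match phase with
  | Some k => reach q0 p0 k t q p
  | None => (exists2 T, chatters_to_rest q0 p0 T q & T <= t) /\ p = 0
  end.

End Model.

(* Main.v *)
Require Import Defs.
From mathcomp Require Import all_boot all_order all_algebra.
From mathcomp Require Import all_classical all_reals all_analysis.
From mathcomp Require Import ring lra measurable_realfun.
Import Order.TTheory GRing.Theory Num.Theory.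
Import numFieldNormedType.Exports.
Local Open Scope ring_scope.

Set Implicit Arguments.
Unset Strict Implicit.
Unset Printing Implicit Defensive.

Local Open Scope classical_set_scope.

(* The change of variables r* = S r in the integral defining the mass matrix
   gives Theta* = |det S| chi Sp Theta Sp^T, while f_i* = Sp f_i.  The scalar
   factor cancels in the impact matrix, so that U_i* = Sp^-T U_i Sp^T, and the
   linear map Sp^-T carries distances, normal velocities and impacts of B to
   those of B*; its inverse carries them back.  The two relations then hold
   along the whole motion because the motion is determined by the initial
   state: a flight cannot be prolonged beyond an impact, so the time and the
   state at the k-th impact are unique. *)

(** * Linear changes of variables in the plane *)

Section Area.
Variable R : realType.
Notation TR := (measurableTypeR R).
Notation leb := (@lebesgue_measure R).

Lemma measurable_affine (a c : R) : measurable_fun setT (fun x : TR => a * x + c : TR).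
Proof.
apply: measurable_funD => //; apply: measurable_funM => //; exact: measurable_id.
Qed.

(** By uniqueness of Lebesgue measure, it suffices that [|a|] times the pushforward agrees with it
    on the intervals []u, v]]. A negative [a] only moves the closed end of the preimage, which does
    not affect its length. *)
Lemma lebesgue_measure_affine (a c : R) (A : set TR) : a != 0 -> measurable A ->
  leb ((fun x : TR => a * x + c : TR) @^-1` A) = (`|a|^-1%:E * leb A)%E.
Proof.
move=> a0 mA; have na0 : 0 < `|a| by rewrite normr_gt0.
pose f : TR -> TR := fun x => a * x + c.
pose mu : {measure set TR -> \bar R} :=
  mscale (NngNum (normr_ge0 a)) (pushforward leb f).
suff : leb A = mu (measurable_affine a c) A.
  rewrite /mu /= /mscale /= /pushforward => ->.
  by rewrite muleA -EFinM mulVf ?mul1e// gt_eqF.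
apply: lebesgue_measure_unique mA => X [[u v] _ <-].
rewrite /mu /= /mscale /= /pushforward.
have [a_gt0|a_lt0] := ltrP 0 a.
  have -> : f @^-1` `]u, v]%classic = `](u - c) / a, (v - c) / a]%classic.
    apply/seteqP; split => x; rewrite /f/= !in_itv/=.
      by rewrite ltr_pdivrMr// ler_pdivlMr// ltrBlDr lerBrDr mulrC.
    by rewrite ltr_pdivrMr// ler_pdivlMr// ltrBlDr lerBrDr mulrC.
  rewrite !lebesgue_measure_itv /= !lte_fin ltr_pM2r ?invr_gt0// ltrD2r.
  case: ifPn => _; last by rewrite mule0.
  by rewrite -!EFinD -EFinM gtr0_norm//; congr EFin; field.
have {a0 }a_lt0 : a < 0 by rewrite lt_neqAle a0.
have -> : f @^-1` `]u, v]%classic = `[(v - c) / a, (u - c) / a[%classic.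
  apply/seteqP; split => x; rewrite /f/= !in_itv/=.
    by rewrite ltr_ndivlMr// ler_ndivrMr// ltrBlDr lerBrDr mulrC andbC.
  by rewrite ltr_ndivlMr// ler_ndivrMr// ltrBlDr lerBrDr mulrC andbC.
rewrite !lebesgue_measure_itv /= !lte_fin ltr_nM2r ?invr_lt0// ltrD2r.
case: ifPn => _; last by rewrite mule0.
by rewrite -!EFinD -EFinM ltr0_norm//; congr EFin; field; rewrite lt_eqF.
Qed.

Definition linear2 (a b c d : R) (z : TR * TR) : TR * TR :=
  (a * z.1 + b * z.2, c * z.1 + d * z.2).

Lemma measurable_linear2 a b c d : measurable_fun setT (linear2 a b c d).
Proof.
by apply: measurable_fun_pair => /=; apply: measurable_funD => //;
  exact: measurable_funM.
Qed.

(** [area] integrates the lengths of sections at fixed abscissa. Both iterated measures agree on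
    rectangles, so sections at fixed ordinate may be used as well. *)
Lemma area_ysection (E : set (TR * TR)) : measurable E ->
  area R E = (product_measure2 leb leb) E.
Proof.
move=> mE; apply: (product_measure_unique (m' := product_measure2 leb leb)) => //.
by move=> A B mA mB; exact: product_measure2E.
Qed.

Lemma measurable_linear2_preimage a b c d (E : set (TR * TR)) :
  measurable E -> measurable (linear2 a b c d @^-1` E).
Proof. by move=> mE; rewrite -[X in measurable X]setTI; exact: measurable_linear2. Qed.

Lemma area_swap (E : set (TR * TR)) : measurable E ->
  area R (linear2 0 1 1 0 @^-1` E) = area R E.
Proof.
move=> mE; rewrite [RHS]area_ysection// /area /product_measure1 /product_measure2.
apply: eq_integral => x _ /=; congr (leb _).
apply/seteqP; split => y; rewrite /xsection /ysection /= !inE /linear2 /=;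
  by rewrite !mul0r !mul1r add0r addr0.
Qed.

(** On each line of fixed ordinate [y] the map is [x |-> a * x + b * y], to which the
    one-dimensional formula applies. *)
Lemma area_shear a b (E : set (TR * TR)) : a != 0 -> measurable E ->
  area R (linear2 a b 0 1 @^-1` E) = (`|a|^-1%:E * area R E)%E.
Proof.
move=> a0 mE; rewrite !area_ysection//; last exact: measurable_linear2_preimage.
rewrite /product_measure2 -ge0_integralZl//=; last first.
  exact: (measurable_fun_ysection leb mE).
apply: eq_integral => y _ /=.
rewrite -(lebesgue_measure_affine (b * y))//; last exact: measurable_ysection.
congr (leb _).
apply/seteqP; split => x; rewrite /ysection /= !inE /linear2 /=;
  by rewrite mul0r mul1r add0r.
Qed.

Lemma linear2_comp (a b c d a' b' c' d' : R) :
  linear2 a' b' c' d' \o linear2 a b c d =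
  linear2 (a' * a + b' * c) (a' * b + b' * d)
          (c' * a + d' * c) (c' * b + d' * d).
Proof. by apply/funext => z; rewrite /linear2 /=; congr pair; ring. Qed.

Lemma area_linear2 a b c d (E : set (TR * TR)) : a * d - b * c != 0 -> measurable E ->
  area R (linear2 a b c d @^-1` E) = (`|a * d - b * c|^-1%:E * area R E)%E.
Proof.
move=> det0 mE.
have mL := measurable_linear2_preimage.
(* The factorization below divides by [a]. If [a = 0] then [b != 0], and precomposing with the swap
   exchanges the columns, which only flips the sign of the determinant. *)
wlog a0 : a b c d det0 / a != 0 => [wlg|].
  have [a0|] := eqVneq a 0; last exact: wlg.
  have b0 : b != 0 by apply: contraNneq det0 => ->; rewrite a0; apply/eqP; ring.
  have detE : b * c - a * d = - (a * d - b * c) by ring.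
  transitivity (area R (linear2 b a d c @^-1` E)); last first.
    by rewrite wlg// detE ?oppr_eq0 ?normrN.
  rewrite -area_swap; last exact: mL.
  rewrite -[X in area R X]/((linear2 a b c d \o linear2 0 1 1 0) @^-1` E).
  by rewrite linear2_comp !mulr0 !mulr1 !add0r !addr0.
(* Row reduction: the matrix is a product of two shears and two swaps. *)
pose e := (a * d - b * c) / a.
have e0 : e != 0 by rewrite mulf_neq0 ?invr_eq0.
have -> : linear2 a b c d = linear2 0 1 1 0 \o (linear2 e (c / a) 0 1 \o
      (linear2 0 1 1 0 \o linear2 a b 0 1)).
  by rewrite !linear2_comp; congr linear2; rewrite /e; field.
rewrite !comp_preimage.
rewrite area_shear//; last first.
  by apply: (mL 0 1 1 0); apply: (mL e (c / a) 0 1); apply: (mL 0 1 1 0).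
rewrite area_swap; last by apply: (mL e (c / a) 0 1); apply: (mL 0 1 1 0).
rewrite area_shear//; last by apply: (mL 0 1 1 0).
rewrite area_swap// muleA -EFinM; congr (_%:E * _)%E.
by rewrite -invfM -normrM /e mulrC divfK.
Qed.

(** The pushforward of [area] under the map is [area] divided by the absolute value of the
    determinant. *)
Lemma ge0_integral_linear2 a b c d (f : TR * TR -> \bar R) : a * d - b * c != 0 ->
  measurable_fun setT f -> (forall z, 0 <= f z)%E ->
  (\int[area R]_z f (linear2 a b c d z) =
   `|a * d - b * c|^-1%:E * \int[area R]_z f z)%E.
Proof.
move=> det0 mf f0.
have k0 : 0 <= `|a * d - b * c|^-1 by rewrite invr_ge0.
rewrite -[`|_|^-1]/((NngNum k0)%:num) -ge0_integral_mscale//.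
have mL := measurable_linear2 a b c d.
have := @ge0_integral_pushforward _ _ _ _ _ _ mL (area R) setT f.
rewrite preimage_setT => <-//.
by apply: eq_measure_integral => E mE _; exact: area_linear2.
Qed.

Lemma Rintegral_linear2 a b c d (f : TR * TR -> R) : a * d - b * c != 0 ->
  (area R).-integrable setT (EFin \o f) ->
  \int[area R]_z f (linear2 a b c d z) = `|a * d - b * c|^-1 * \int[area R]_z f z.
Proof.
move=> det0 intf; have mf := measurable_int _ intf.
rewrite /Rintegral integralE [in RHS]integralE.
transitivity (fine
    (\int[area R]_z ((EFin \o f)^\+ (linear2 a b c d z)) -
     \int[area R]_z ((EFin \o f)^\- (linear2 a b c d z)))%E).
  by congr (fine (_ - _)%E); apply: eq_integral => z _; rewrite ?funeposE ?funenegE.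
rewrite !ge0_integral_linear2//; last 2 first.
  exact: measurable_funeneg.
  exact: measurable_funepos.
(* Factoring out of the difference requires that it is not of the form infinity minus infinity;
   integrability makes the negative part finite. *)
rewrite -muleBr//; last first.
  apply: fin_num_adde_defl.
  by rewrite fin_numN integrable_neg_fin_num.
rewrite fineM//.
rewrite -integralE; exact: integrable_fin_num.
Qed.

Lemma measurable_affine2 (a b c : R) :
  measurable_fun setT (fun z : TR * TR => a * z.1 + b * z.2 + c : R).
Proof. by do 2?apply: measurable_funD => //; exact: measurable_funM. Qed.

Lemma measurable_line (a b c : R) :
  measurable [set z : TR * TR | a * z.1 + b * z.2 + c = 0].
Proof.
rewrite -[X in measurable X]setTI.
exact: (measurable_affine2 a b c measurableT (measurable_set1 0)).
Qed.

(** Sections along a coordinate with nonzero coefficient are single points; if [a = b = 0], then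
    [c != 0] and the set is empty. *)
Lemma area_line (a b c : R) : ~~ [&& a == 0, b == 0 & c == 0] ->
  area R [set z : TR * TR | a * z.1 + b * z.2 + c = 0] = 0%E.
Proof.
have affine_root (u t x : R) : u != 0 -> (u * x + t = 0) <-> (x = - t / u).
  move=> u0; split=> [h|->]; last by field.
  by have -> : t = - (u * x) by [lra]; field.
have mE := measurable_line a b c; move: mE; set E := [set _ | _] => mE.
have [a0|a0 _] := eqVneq a 0; last first.
  rewrite area_ysection// /product_measure2; apply: integral0_eq => y _ /=.
  suff -> : ysection E y = [set - (b * y + c) / a] by exact: lebesgue_measure_set1.
  by apply/seteqP; split=> x; rewrite /ysection/E/= inE/= -addrA affine_root.
have [b0 /= c0|b0 _] := eqVneq b 0.
  suff -> : E = set0 by rewrite measure0.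
  by rewrite -subset0 => z; rewrite /E/= a0 b0 !mul0r !add0r; exact/eqP.
rewrite /area /product_measure1; apply: integral0_eq => x _ /=.
suff -> : xsection E x = [set - c / b] by exact: lebesgue_measure_set1.
by apply/seteqP; split=> y; rewrite /xsection/E/= inE/= a0 mul0r add0r affine_root.
Qed.

Lemma Rintegral_sum d (T : measurableType d) (mu : {measure set T -> \bar R})
    (D : set T) (I : Type) (s : seq I) (f : I -> T -> R) : measurable D ->
  (forall i, mu.-integrable D (EFin \o f i)) ->
  \int[mu]_(x in D) (\sum_(i <- s) f i x) = \sum_(i <- s) \int[mu]_(x in D) f i x.
Proof.
move=> mD intf; rewrite /Rintegral.
under eq_integral do rewrite -sumEFin.
rewrite (integral_sum mD (f := fun i => EFin \o f i))//.
by rewrite sum_fine => [//|i _]; exact: (integrable_fin_num mD (intf i)).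
Qed.

End Area.

(** * The mass matrix *)

Section MassMatrix.
Variable R : realType.
Notation TR := (measurableTypeR R).

Lemma mulmx_PN_P (t : R) : P (- t) *m P t = 1%:M.
Proof.
have sc := cos2Dsin2 t.
apply/matrixP => i j; rewrite !mxE !big_ord_recl big_ord0 !mxE /= cosN sinN.
case: i => -[|[|[|//]]] ?; case: j => -[|[|[|//]]] ? /=;
  rewrite ?mulr1n ?mulr0n; solve [ring | rewrite -sc; ring].
Qed.

Lemma trmx_P (t : R) : (P t)^T = P (- t).
Proof.
apply/matrixP => i j; rewrite !mxE cosN sinN opprK.
by case: i => -[|[|[|//]]] ?; case: j => -[|[|[|//]]] ?.
Qed.

(** This extends the contact direction from the vertices to every point of the plane, so that the
    mass matrix integrates the density times [lever xy *m (lever xy)^T]. *)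
Definition lever (xy : R * R) : 'cV[R]_3 := P (- (pi / 2)) *m (plane_pt xy + u3 R).

Lemma leverE xy : lever xy = \col_(k < 3) [:: xy.2; - xy.1; 1]`_k.
Proof.
apply/matrixP => k l; rewrite (ord1 l) !mxE !big_ord_recl big_ord0 !mxE /=.
rewrite cosN sinN cos_pihalf sin_pihalf opprK.
case: k => -[|[|[|]]] //= _; lra.
Qed.

Section Body.
Variables (n : nat) (B : flat_body R n).

Lemma mass_matrixE k l :
  mass_matrix B k l =
  \int[area R]_xy (density B (plane_pt xy) * (lever xy k 0 * lever xy l 0)).
Proof.
rewrite mxE; apply: eq_Rintegral => xy _; congr (_ * _).
have -> : P (pi / 2) = (P (- (pi / 2)))^T :> 'M[R]_3 by rewrite trmx_P opprK.
rewrite -mulmxA -trmx_mul -/(lever xy).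
by rewrite mxE big_ord1 [_^T _ _]mxE.
Qed.

Lemma measurable_lever k : measurable_fun setT (fun xy : TR * TR => lever xy k 0).
Proof.
under eq_fun do rewrite leverE mxE.
case: k => -[|[|[|//]]] _ /=.
- exact: measurable_snd.
- exact: measurableT_comp measurable_fst.
- exact: measurable_cst.
Qed.

Lemma measurable_density :
  measurable_fun setT (fun xy : TR * TR => density B (plane_pt xy)).
Proof.
have mint := measurable_int _ (density_integrable B).
exact/measurable_EFinP.
Qed.

(** The entries of [lever] are [y], [-x] and [1], so a product of two of them is bounded by
    [1 + x^2 + y^2]; the density times this bound is integrable by the two integrability fields of
    [flat_body]. *)
Lemma integrable_mass k l : (area R).-integrable setT
  (fun xy => (density B (plane_pt xy) * (lever xy k 0 * lever xy l 0))%:E).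
Proof.
apply: (le_integrable measurableT _ _
  (integrableD measurableT (density_integrable B) (moment2_integrable B))).
  apply/measurable_EFinP; apply: measurable_funM; first exact: measurable_density.
  by apply: measurable_funM; exact: measurable_lever.
move=> [x y] _; rewrite /= lee_fin.
have d0 := density_ge0 B (x, y).
have q0 : 0 <= x ^+ 2 + y ^+ 2 by rewrite addr_ge0 ?sqr_ge0.
rewrite -[X in _ <= `|X + _|]mulr1 -mulrDr !normrM ler_wpM2l//.
rewrite -normrM [leRHS]ger0_norm ?addr_ge0 ?sqr_ge0//.
rewrite !leverE !mxE ler_norml; apply/andP; split;
case: k => -[|[|[|//]]] ?; case: l => -[|[|[|//]]] ? /=; nra.
Qed.

Section Form.
Variables (m1 m2 : nat) (A : 'M[R]_(m1, 3)) (C : 'M[R]_(3, m2)) (i : 'I_m1) (j : 'I_m2).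

Let F l k (xy : TR * TR) : R :=
  A i k * C l j * (density B (plane_pt xy) * (lever xy k 0 * lever xy l 0)).

Let intF l k : (area R).-integrable setT (EFin \o F l k).
Proof.
rewrite /F /comp; under eq_fun do rewrite EFinM.
by apply: integrableZl => //; exact: integrable_mass.
Qed.

Let sumF xy : density B (plane_pt xy) * (A *m (lever xy *m (lever xy)^T) *m C) i j =
  \sum_l \sum_k F l k xy.
Proof.
rewrite mxE mulr_sumr; apply: eq_bigr => l _.
rewrite mxE mulr_suml mulr_sumr; apply: eq_bigr => k _.
by rewrite /F [(lever xy *m _) _ _]mxE big_ord1 [_^T _ _]mxE; ring.
Qed.

Let int_sumF l : (area R).-integrable setT (EFin \o fun xy => \sum_k F l k xy).
Proof.
rewrite /comp; under eq_fun do rewrite -sumEFin.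
by apply: integrable_sum => // k _; exact: intF.
Qed.

Lemma integrable_mass_form : (area R).-integrable setT
  (fun xy => (density B (plane_pt xy) *
     (A *m (lever xy *m (lever xy)^T) *m C) i j)%:E).
Proof.
under eq_fun do rewrite sumF -sumEFin.
by apply: integrable_sum => // l _; exact: int_sumF.
Qed.

(** Linearity of the integral. The choice [A = v], [C = v^T] gives the quadratic form behind
    invertibility; [A = Sp], [C = Sp^T] gives the transformation law of the mass matrix. *)
Lemma mass_matrix_form :
  (A *m mass_matrix B *m C) i j =
  \int[area R]_xy (density B (plane_pt xy) *
    (A *m (lever xy *m (lever xy)^T) *m C) i j).
Proof.
transitivity (\sum_l \sum_k \int[area R]_xy F l k xy).
  rewrite mxE; apply: eq_bigr => l _; rewrite mxE mulr_suml; apply: eq_bigr => k _.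
  rewrite RintegralZl//; last exact: integrable_mass.
  by rewrite mass_matrixE mulrAC.
under [RHS]eq_Rintegral do rewrite sumF.
rewrite Rintegral_sum//.
by apply: eq_bigr => l _; rewrite Rintegral_sum.
Qed.

End Form.

End Body.

Lemma ord3_sum (V : nmodType) (F : 'I_3 -> V) :
  \sum_i F i = F 0 + F 1 + F ord_max.
Proof.
rewrite !big_ord_recl big_ord0 addr0 addrA.
by congr (F _ + F _ + F _); apply/val_inj.
Qed.

(* [v *m mass_matrix B *m v^T] is the integral of the density times the square
   of an affine function of the plane, whose zero set has area 0. *)
Lemma mass_matrix_unit n (B : flat_body R n) : mass_matrix B \in unitmx.
Proof.
rewrite unitmxE unitfE; apply/negP => /det0P [v v0 vT].
(* Since [lever xy] is [(y, -x, 1)], these are the coefficients of [v *m lever xy] as an affine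
   function of [xy]. *)
pose a := - v 0 1; pose b := v 0 0; pose c := v 0 ord_max.
pose F xy : R := density B (plane_pt xy) * (a * xy.1 + b * xy.2 + c) ^+ 2.
have FE xy : density B (plane_pt xy) *
    (v *m (lever xy *m (lever xy)^T) *m v^T) 0 0 = F xy.
  rewrite /F; congr (_ * _).
  have -> : a * xy.1 + b * xy.2 + c = (v *m lever xy) 0 0.
    rewrite mxE ord3_sum leverE !mxE /= /a /b /c; ring.
  by rewrite mulmxA -mulmxA -trmx_mul mxE big_ord1 [_^T _ _]mxE expr2.
have intF : (area R).-integrable setT (EFin \o F).
  have := integrable_mass_form B v v^T 0 0.
  by under eq_fun do rewrite FE.
have F0 : (\int[area R]_xy `|(EFin \o F) xy| = 0)%E.
  transitivity (\int[area R]_xy (EFin \o F) xy)%E.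
    apply: eq_integral => xy _; rewrite gee0_abs// lee_fin.
    by rewrite mulr_ge0 ?sqr_ge0// density_ge0.
  rewrite -[LHS]fineK; last exact: (integrable_fin_num measurableT intF).
  congr (_%:E); have := mass_matrix_form B v v^T 0 0.
  by under eq_Rintegral do rewrite FE; rewrite vT mul0mx mxE => /esym.
have /ae_eq_integral_abs-/(_ measurableT (measurable_int _ intF)) := F0 => F0ae.
have line : ~~ [&& a == 0, b == 0 & c == 0].
  apply: contra v0 => /and3P[/eqP a0 /eqP b0 /eqP c0]; apply/eqP/rowP => i.
  have v1 : v 0 1 = 0 by rewrite -[LHS]opprK -/a a0 oppr0.
  by rewrite mxE; case: i => -[|[|[|//]]] ?; [rewrite -[RHS]b0|rewrite -[RHS]v1|
    rewrite -[RHS]c0]; congr (v 0 _); apply/val_inj.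
have line_ae : {ae area R, forall xy, a * xy.1 + b * xy.2 + c != 0}.
  exists [set z | a * z.1 + b * z.2 + c = 0]; split; first exact: measurable_line.
  - exact: area_line.
  - by move=> z /= /negP; rewrite negbK => /eqP.
(* [F] vanishes almost everywhere while its squared factor vanishes only on a null set, so the
   density is almost everywhere zero, against the positive mass. *)
have dens0 : ae_eq (area R) setT (fun xy => (density B (plane_pt xy))%:E) (cst 0%E).
  apply: filterS2 F0ae line_ae => xy /= + nz _.
  move=> /(_ I) [] /eqP; rewrite mulf_eq0 expf_eq0/= (negPf nz) orbF => /eqP ->.
  by [].
have md := measurable_int _ (density_integrable B).
have := mass_gt0 B; rewrite /Rintegral.
rewrite (ae_eq_integral (cst 0%E) _ measurableT md _ dens0)//.
by rewrite integral0 ltxx.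
Qed.

Lemma det_affine_mx (a b c d : R) :
  \det (mx3 [:: [:: a; b; 0]; [:: c; d; 0]; [:: 0; 0; 1]]) = a * d - b * c.
Proof.
rewrite (expand_det_row _ ord_max) ord3_sum !mxE /= !mul0r !add0r mul1r.
rewrite /cofactor (expand_det_row _ 0) big_ord_recl big_ord1 /cofactor !det_mx11 !mxE /=.
ring.
Qed.

Lemma invmx_congruence m (A Th : 'M[R]_m) (k : R) :
  A \in unitmx -> Th \in unitmx -> k != 0 ->
  invmx (k *: (A *m Th *m A^T)) = k^-1 *: (invmx A^T *m invmx Th *m invmx A).
Proof.
move=> Au Tu k0; have Atu : A^T \in unitmx by rewrite unitmx_tr.
have Xu : k *: (A *m Th *m A^T) \in unitmx.
  by rewrite unitmxZ ?unitfE// !unitmx_mul Au Tu Atu.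
apply: (can_inj (mulKmx Xu)); rewrite mulmxV//.
rewrite -scalemxAl -scalemxAr scalerA divff// scale1r.
by rewrite !mulmxA (mulmxK Atu) (mulmxK Tu) mulmxV.
Qed.

(** The impact matrix with mass matrix, contact direction and [r = 1 + restitution] as parameters,
    which turns its transformation law into pure matrix algebra. *)
Definition collision_mx m (Th : 'M[R]_m) (f : 'cV[R]_m) (r : R) : 'M[R]_m :=
  1%:M - r / (f^T *m invmx Th *m f) 0 0 *: (invmx Th *m f *m f^T).

(** The inverse mass matrix contributes [k^-1] to numerator and denominator alike, so [k] cancels.
    In the denominator the copies of [A] cancel too; in the numerator they survive only at the two
    ends, as a conjugation. *)
Lemma collision_mx_congruence m (A Th : 'M[R]_m) (f : 'cV[R]_m) (k r : R) :
  A \in unitmx -> Th \in unitmx -> k != 0 ->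
  collision_mx (k *: (A *m Th *m A^T)) (A *m f) r =
  invmx A^T *m collision_mx Th f r *m A^T.
Proof.
move=> Au Tu k0; have Atu : A^T \in unitmx by rewrite unitmx_tr.
have invf : invmx (k *: (A *m Th *m A^T)) *m (A *m f) =
    k^-1 *: (invmx A^T *m (invmx Th *m f)).
  by rewrite invmx_congruence// -scalemxAl -!mulmxA (mulKmx Au).
have finvf : ((A *m f)^T *m invmx (k *: (A *m Th *m A^T)) *m (A *m f)) 0 0 =
    k^-1 * (f^T *m invmx Th *m f) 0 0.
  rewrite -mulmxA invf trmx_mul -scalemxAr mxE; congr (_ * _).
  by rewrite -!mulmxA (mulKVmx Atu).
rewrite /collision_mx finvf invf mulmxBr mulmx1 mulmxBl mulVmx//; congr (_ - _).
rewrite -scalemxAl scalerA -scalemxAr -scalemxAl invfM invrK.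
rewrite trmx_mul !mulmxA; congr (_ *: _).
by rewrite mulrA mulrAC; congr (_ * _); rewrite -mulrA mulfV ?mulr1.
Qed.

(** * Mass and impact matrices of an affine image *)

Section AffineImage.
Variables (n : nat) (B Bs : flat_body R n) (a b c d chi : R).
Let S : 'M[R]_3 := mx3 [:: [:: a; b; 0]; [:: c; d; 0]; [:: 0; 0; 1]].
Let Sp : 'M[R]_3 := P (- (pi / 2)) *m S *m P (pi / 2).
Hypothesis Sunit : S \in unitmx.
Hypothesis same_restitution : restitution Bs = restitution B.
Hypothesis vertexS : forall i : 'I_n, vertex Bs i = S *m vertex B i.
Hypothesis densityS : forall xy : R * R,
  density Bs (S *m plane_pt xy) = chi * density B (plane_pt xy).

Let det0 : a * d - b * c != 0.
Proof. by move: Sunit; rewrite unitmxE unitfE det_affine_mx. Qed.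

Lemma Sp_unit : Sp \in unitmx.
Proof.
have PNP := mulmx_PN_P (pi / 2 : R).
have [PN1 P1] := mulmx1_unit PNP.
by rewrite !unitmx_mul PN1 Sunit P1.
Qed.

Let S_plane_pt xy : S *m plane_pt xy = plane_pt (linear2 a b c d xy).
Proof.
apply/matrixP => k l; rewrite (ord1 l) !mxE ord3_sum !mxE /=.
by case: k => -[|[|[|//]]] ? /=; ring.
Qed.

Let S_u3 : S *m u3 R = u3 R.
Proof.
apply/matrixP => k l; rewrite (ord1 l) !mxE ord3_sum !mxE /=.
by case: k => -[|[|[|//]]] ? /=; ring.
Qed.

(** The inner quarter turns cancel; hence [lever] and [contact_dir] both transform by [Sp]. *)
Let Sp_P (w : 'cV[R]_3) : Sp *m (P (- (pi / 2)) *m w) = P (- (pi / 2)) *m (S *m w).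
Proof.
have PPN : P (pi / 2) *m P (- (pi / 2)) = 1%:M :> 'M[R]_3.
  by have := mulmx_PN_P (- (pi / 2 : R)); rewrite opprK.
by rewrite /Sp -!mulmxA (mulmxA (P (pi / 2))) PPN mul1mx.
Qed.

Lemma lever_linear2 xy : lever (linear2 a b c d xy) = Sp *m lever xy.
Proof. by rewrite /lever Sp_P [S *m (_ + _)]mulmxDr S_u3 S_plane_pt. Qed.

Lemma contact_dir_affine i : contact_dir Bs i = Sp *m contact_dir B i.
Proof. by rewrite /contact_dir Sp_P [S *m (_ + _)]mulmxDr S_u3 vertexS. Qed.

(** Serves to exclude [chi = 0], under which the image would have no mass. *)
Lemma mass_affine :
  \int[area R]_xy density Bs (plane_pt xy) =
  `|a * d - b * c| * chi * \int[area R]_xy density B (plane_pt xy).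
Proof.
have := Rintegral_linear2 det0 (density_integrable Bs).
under eq_Rintegral do rewrite -S_plane_pt densityS.
rewrite RintegralZl//; last exact: density_integrable.
by move=> H; rewrite -mulrA H mulVKf// normr_eq0.
Qed.

Lemma chi_neq0 : chi != 0.
Proof.
apply: contraTneq (mass_gt0 Bs) => chi0.
by rewrite mass_affine chi0 mulr0 mul0r ltxx.
Qed.

Lemma mass_matrix_affine :
  mass_matrix Bs = (`|a * d - b * c| * chi) *: (Sp *m mass_matrix B *m Sp^T).
Proof.
apply/matrixP => k l; rewrite mass_matrixE [RHS]mxE mass_matrix_form.
have := Rintegral_linear2 det0 (integrable_mass Bs k l).
under eq_Rintegral do rewrite -S_plane_pt densityS !lever_linear2.
move=> /(congr1 ( *%R `|a * d - b * c|)); rewrite mulVKf ?normr_eq0// => <-.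
rewrite -mulrA; congr (_ * _).
rewrite -RintegralZl//; last exact: integrable_mass_form.
apply: eq_Rintegral => xy _; rewrite -mulrA; congr (_ * (_ * _)).
by rewrite mulmxA -mulmxA -trmx_mul [RHS]mxE big_ord1 [_^T _ _]mxE.
Qed.

Lemma impact_mx_affine i :
  impact_mx Bs i = invmx Sp^T *m impact_mx B i *m Sp^T.
Proof.
rewrite /impact_mx /= contact_dir_affine same_restitution mass_matrix_affine.
apply: collision_mx_congruence; first exact: Sp_unit; first exact: mass_matrix_unit.
by rewrite mulf_neq0 ?normr_eq0 ?chi_neq0.
Qed.

Lemma gap_affine i q : gap Bs i (invmx Sp^T *m q) = gap B i q.
Proof.
have StU : Sp^T \in unitmx by rewrite unitmx_tr Sp_unit.
by rewrite /gap contact_dir_affine trmx_mul -mulmxA (mulKVmx StU).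
Qed.

End AffineImage.
End MassMatrix.

(** * The motion *)

Section Motion.
Variables (R : realType) (n : nat).
Implicit Types (B : flat_body R n) (q p : 'cV[R]_3).

Lemma cvg_mulmx (M : 'M[R]_3) (u : nat -> 'cV[R]_3) (l : 'cV[R]_3) :
  u @ \oo --> l -> (fun k => M *m u k) @ \oo --> M *m l.
Proof.
move=> ul.
(* As a combination of the columns of [M], the product reduces convergence to that of each
   coordinate. *)
have colE (x : 'cV[R]_3) : M *m x = \sum_(i < 3) x i 0 *: col i M.
  apply/matrixP => r s; rewrite (ord1 s) mxE summxE.
  by apply: eq_bigr => i _; rewrite !mxE mulrC.
rewrite colE; under eq_fun do rewrite colE.
apply: cvg_big => [|i _]; first exact: add_continuous.
apply: cvgZr_tmp.
exact: (cvg_comp _ _ ul (@coord_continuous _ _ _ i 0 l)).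
Qed.

(** Stated for an arbitrary intertwining [M], so that it applies to [Sp^-T] and to its inverse
    alike. *)
Lemma reach_similar B Bs (M : 'M[R]_3) :
  (forall i q, gap Bs i (M *m q) = gap B i q) ->
  (forall i, impact_mx Bs i *m M = M *m impact_mx B i) ->
  forall q0 p0 k t q p, reach B q0 p0 k t q p ->
  reach Bs (M *m q0) (M *m p0) k t (M *m q) (M *m p).
Proof.
move=> gapM impM q0 p0 k t q p.
have admM x : admissible B x -> admissible Bs (M *m x).
  by move=> ax i; rewrite gapM.
have impacM j x y : impacting Bs j (M *m x) (M *m y) <-> impacting B j x y.
  (* Normal velocity is the same linear form as the gap, so [gapM] covers both. *)
  by rewrite /impacting /normal_velocity -!/(gap _ _ _) !gapM.
elim=> [adm|{}k {}t {}q {}p dt _ IH dt0 adm|{}k {}t {}q {}p i _ IH imp uniq].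
- by apply: reach_start; exact: admM.
- rewrite mulmxDr -scalemxAr; apply: reach_flight => // s s_dt.
  by rewrite scalemxAr -mulmxDr; apply/admM/adm.
- rewrite mulmxA -impM -mulmxA; apply: reach_impact => //; first exact/impacM.
  by move=> j /impacM; exact: uniq.
Qed.

(** * Uniqueness of the motion from a given initial state *)

Section Determinism.
Variables (B : flat_body R n) (q0 p0 : 'cV[R]_3).
Local Notation reach := (reach B q0 p0).

(* [enters k t q p]: the phase with exactly k impacts begins at time t in state (q, p). *)
Inductive enters : nat -> R -> 'cV[R]_3 -> 'cV[R]_3 -> Prop :=
| enters0 : enters 0 0 q0 p0
| entersS k t q p i : reach k t q p -> impacting B i q p ->
    (forall j, impacting B j q p -> j = i) ->
    enters k.+1 t q (impact_mx B i *m p).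

Lemma reach_admissible k t q p : reach k t q p -> admissible B q.
Proof.
by elim=> // {}k {}t {}q {}p dt _ _ dt0; apply; rewrite dt0 lexx.
Qed.

(** Consecutive flights within one phase have the same velocity and merge into a single one from the
    entry state. *)
Lemma reach_enters k t q p : reach k t q p ->
  exists tau q1, enters k tau q1 p /\ q = q1 + (t - tau) *: p.
Proof.
elim=> [_|{}k {}t {}q {}p dt _ [tau [q1 [en qE]]] _ _|{}k {}t {}q {}p i rkt _ imp uniq].
- by exists 0, q0; split; [exact: enters0|rewrite subrr scale0r addr0].
- exists tau, q1; split=> //.
  by rewrite qE -addrA -scalerDl; congr (_ + _ *: _); ring.
- exists t, q; split; first exact: (entersS rkt imp).
  by rewrite subrr scale0r addr0.
Qed.

Lemma gap_flight i q p s : gap B i (q + s *: p) = gap B i q + s * normal_velocity B i p.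
Proof.
by rewrite /gap mulmxDr -scalemxAr [LHS]mxE; congr (_ + _); rewrite mxE.
Qed.

(** The gap starts at zero with negative slope, so any positive duration would make it negative. *)
Lemma impact_ends_flight i q p s :
  impacting B i q p -> 0 <= s -> admissible B (q + s *: p) -> s = 0.
Proof.
move=> [g0 v0] s0 /(_ i); rewrite gap_flight g0 add0r => sv.
by apply/le_anti; rewrite s0 andbT -(nmulr_lge0 _ v0).
Qed.

(** Named separately because [reach_later] assumes it at [k] within the induction that proves it for
    all [k]. *)
Definition enters_unique k := forall tau q p tau' q' p',
  enters k tau q p -> enters k tau' q' p' -> [/\ tau = tau', q = q' & p = p'].

(** With a unique entry, two states of one phase lie on the same flight line. The admissibility
    clause is what [impact_ends_flight] consumes. *)
Lemma reach_later k t q p t' q' p' : enters_unique k ->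
  reach k t q p -> reach k t' q' p' -> t <= t' ->
  [/\ p' = p, q' = q + (t' - t) *: p & admissible B (q + (t' - t) *: p)].
Proof.
move=> uniq /reach_enters [tau [q1 [en qE]]] r' tt'.
have [tau' [q1' [en' qE']]] := reach_enters r'.
have [tauE q1E pE] := uniq _ _ _ _ _ _ en en'; subst tau' q1' p'.
have qq' : q' = q + (t' - t) *: p.
  by rewrite qE' qE -addrA -scalerDl; congr (_ + _ *: _); ring.
by split=> //; rewrite -qq'; exact: reach_admissible r'.
Qed.

(** If phase [k] ended at two different times, the later state would admissibly prolong the flight
    past the earlier impact. *)
Lemma enters_is_unique k : enters_unique k.
Proof.
elim: k => [|k IH] tau q p tau' q' p' en en'.
  by inversion en; inversion en'; subst.
inversion en as [|k1 t1 q1 p1 i r imp uniq]; subst.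
inversion en' as [|k1 t1 q1 p2 i' r' imp' uniq']; subst.
have tt' : tau = tau'.
  have [le_tt'|/ltW le_t't] := leP tau tau'.
    have [_ _ adm] := reach_later IH r r' le_tt'.
    by apply/eqP; rewrite eq_sym -subr_eq0 (impact_ends_flight imp _ adm) ?subr_ge0.
  have [_ _ adm] := reach_later IH r' r le_t't.
  by apply/eqP; rewrite -subr_eq0 (impact_ends_flight imp' _ adm) ?subr_ge0.
subst tau'; have [pE qE _] := reach_later IH r r' (lexx _).
move: qE; rewrite subrr scale0r addr0 => qE; subst.
(* Only one vertex is impacting, so both entries apply the same impact matrix. *)
by rewrite (uniq' i).
Qed.

Lemma reach_deterministic k t q p q' p' :
  reach k t q p -> reach k t q' p' -> q' = q /\ p' = p.
Proof.
move=> r r'; have [-> -> _] := reach_later (@enters_is_unique k) r r' (lexx _).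
by rewrite subrr scale0r addr0.
Qed.

(** Two witnessing sequences may sample phase [k] at different times, but on the same flight line.
    The discrepancy [(t_' k - t_ k) *: p_ k] tends to [(T' - T) *: 0 = 0], without identifying [T]
    and [T']. *)
Lemma rest_unique T T' q q' : chatters_to_rest B q0 p0 T q ->
  chatters_to_rest B q0 p0 T' q' -> q' = q.
Proof.
move=> [t_ [q_ [p_ [r tT qq pp]]]] [t_' [q_' [p_' [r' tT' qq' _]]]].
have qE k : q_' k = q_ k + (t_' k - t_ k) *: p_ k.
  have [le_tt'|/ltW le_t't] := leP (t_ k) (t_' k).
    by have [_ ->] := reach_later (@enters_is_unique k) (r k) (r' k) le_tt'.
  have [-> -> _] := reach_later (@enters_is_unique k) (r' k) (r k) le_t't.
  by rewrite -addrA -scalerDl -[LHS]addr0 -[in LHS](scale0r (p_' k));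
    congr (_ + _ *: _); ring.
have q'q : q_' @ \oo --> q.
  under eq_cvg do rewrite qE.
  rewrite -[q]addr0 -(scaler0 _ (T' - T)).
  by apply: cvgD => //; apply: cvgZ => //; exact: cvgB.
exact: (cvg_unique (@norm_hausdorff _ _) qq' q'q).
Qed.

End Determinism.

Lemma chatters_similar B Bs (M : 'M[R]_3) :
  (forall i q, gap Bs i (M *m q) = gap B i q) ->
  (forall i, impact_mx Bs i *m M = M *m impact_mx B i) ->
  forall q0 p0 T q, chatters_to_rest B q0 p0 T q ->
  chatters_to_rest Bs (M *m q0) (M *m p0) T (M *m q).
Proof.
move=> gapM impM q0 p0 T q [t_ [q_ [p_ [r tT qq pp]]]].
exists t_, (fun k => M *m q_ k), (fun k => M *m p_ k); split=> //.
- by move=> k; exact: reach_similar.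
- exact: cvg_mulmx.
- by rewrite -[0](mulmx0 _ M); exact: cvg_mulmx.
Qed.

Lemma motion_similar B Bs (M : 'M[R]_3) :
  (forall i q, gap Bs i (M *m q) = gap B i q) ->
  (forall i, impact_mx Bs i *m M = M *m impact_mx B i) ->
  forall q0 p0 ph t q p, motion B q0 p0 ph t q p ->
  motion Bs (M *m q0) (M *m p0) ph t (M *m q) (M *m p).
Proof.
move=> gapM impM q0 p0 [k|] t q p /=; first exact: reach_similar.
move=> [[T cT Tt] ->]; rewrite mulmx0; split=> //; exists T => //.
exact: chatters_similar.
Qed.

Lemma motion_deterministic B q0 p0 ph t q p q' p' :
  motion B q0 p0 ph t q p -> motion B q0 p0 ph t q' p' -> q' = q /\ p' = p.
Proof.
case: ph => [k|] /=; first exact: reach_deterministic.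
by move=> [[T cT _] ->] [[T' cT' _] ->]; rewrite (rest_unique cT cT').
Qed.

End Motion.

Theorem theorem7 (R : realType) (n : nat) (B Bs : flat_body R n)
    (a b c d chi : R) (q p qs ps : 'cV[R]_3) :
  let S : 'M[R]_3 := mx3 [:: [:: a; b; 0]; [:: c; d; 0]; [:: 0; 0; 1]] in
  let Sp : 'M[R]_3 := P (- (pi / 2)) *m S *m P (pi / 2) in
  S \in unitmx ->
  restitution Bs = restitution B ->
  (forall i : 'I_n, vertex Bs i = S *m vertex B i) ->
  (forall xy : R * R,
     density Bs (S *m plane_pt xy) = chi * density B (plane_pt xy)) ->
  qs = invmx Sp^T *m q ->
  ps = invmx Sp^T *m p ->
  [/\ (forall (m : option nat) (t : R) (q1 p1 : 'cV[R]_3),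
         motion B q p m t q1 p1 <->
         motion Bs qs ps m t (invmx Sp^T *m q1) (invmx Sp^T *m p1)),
      (forall (m : option nat) (t : R) (q1 p1 q1s p1s : 'cV[R]_3),
         motion B q p m t q1 p1 -> motion Bs qs ps m t q1s p1s ->
         q1s = invmx Sp^T *m q1 /\ p1s = invmx Sp^T *m p1) &
      (complete_chatter Bs qs ps <-> complete_chatter B q p)].
Proof.
move=> S Sp Su rest vert dens -> ->.
have StU : Sp^T \in unitmx by rewrite unitmx_tr; exact: Sp_unit.
have gapE := gap_affine Su vert.
have impE := impact_mx_affine Su rest vert dens.
move: StU gapE impE; rewrite -/S -/Sp; set N := Sp^T; set M := invmx N => NU gapE impE.
have impM i : impact_mx Bs i *m M = M *m impact_mx B i.
  by rewrite impE (mulmxK NU).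
(* The same two intertwining relations for the inverse [N] of [M], which carry the motion of [Bs]
   back to [B]. *)
have gapN i x : gap B i (N *m x) = gap Bs i x by rewrite -gapE /M (mulKmx NU).
have impN i : impact_mx B i *m N = N *m impact_mx Bs i.
  by rewrite impE -mulmxA (mulKVmx NU).
have NM (x : 'cV[R]_3) : N *m (M *m x) = x by exact: (mulKVmx NU).
have motionE ph t q1 p1 :
    motion B q p ph t q1 p1 <-> motion Bs (M *m q) (M *m p) ph t (M *m q1) (M *m p1).
  split=> [|mot]; first exact: motion_similar.
  by have := motion_similar gapN impN mot; rewrite !NM.
(* The image of the state of [B] is a state of [Bs] in the same phase and at the same time, so
   determinism for [Bs] identifies it with the given one. *)
split=> // [ph t q1 p1 q1s p1s /motionE mot mots|].
  exact: (motion_deterministic mot mots).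
split=> -[T [qT cT]].
  by exists T, (N *m qT); have := chatters_similar gapN impN cT; rewrite !NM.
by exists T, (M *m qT); exact: chatters_similar.
Qed.
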